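(* Let $q$ be a prime power, $r$ a prime with $r\mid(q-1)$ and $r\ge 3$, $q/2\le\ell\le q-1$, and $s\mid(q-1)/r$. Assume the following uncertainty principle holds for $r$ over $\mathbb{F}_q$: every nonzero $f\in\mathbb{F}_q[X]$ of degree $<r$ satisfies $|f|+|\{x\in\Omega_r: f(x)\neq0\}|\geq r+1$, where $|f|$ is the number of nonzero coefficients of $f$ and $\Omega_r=\{x\in\mathbb{F}_q^*:x^r=1\}$. Then the folded quantum Tamo–Barg code with parameters $q,r,\ell,s$ has distance at least \[ d=\frac{q-1}{s}\left(1-\frac{\ell-1}{q-1}-\epsilon\right),\quad\text{where}\quad \epsilon=\max_{1\leq m\leq r}\min\left\{\left(1-\frac{\ell-1}{q-1}\right)\frac{m-1}{r},\ \frac{1}{m}+\frac{m-1}{s}\right\}. \]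
   Context: $[n]=\{0,\dots,n-1\}$, $\mathbb{F}_q^*=\mathbb{F}_q\setminus\{0\}$. For $S\subseteq\mathbb{Z}_{\ge0}$, $\mathbb{F}_q[X]^S=\{\sum_{i\in S}a_iX^i\}$, $\mathrm{ev}(f)=(f(x))_{x\in\mathbb{F}_q^*}$. Let $S=\{i\in[\ell]:i\not\equiv r-1\pmod r\}\cup\{i\in[q-1]:i\equiv1\pmod r\}$, $C=\mathrm{ev}(\mathbb{F}_q[X]^S)$; for $\ell\ge q/2$, $C^\perp\subseteq C$ and the quantum Tamo–Barg code is $\mathrm{CSS}(C,C)=\mathrm{span}\{\sum_{y\in C^\perp}|x+y\rangle:x\in C\}$, qudits indexed by $\mathbb{F}_q^*$. Folding: fix a generator $\omega$ of $\mathbb{F}_q^*$ and for $i\in[(q-1)/s]$ group the $s$ positions $\{\omega^{si},\dots,\omega^{si+s-1}\}$ into one symbol (alphabet $\mathbb{F}_q^s$, local dimension $q^s$), giving the folded quantum Tamo–Barg code of block length $(q-1)/s$. Its distance is the minimum, over $c\in C\setminus C^\perp$, of the number of blocks $\{\omega^{si},\dots,\omega^{si+s-1}\}$ on which $c$ is not identically zero. *)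

(* Defs.v *)
From HB Require Import structures.
From mathcomp Require Import all_boot all_order all_algebra.
Set Implicit Arguments. Unset Strict Implicit. Unset Printing Implicit Defensive.
Import Order.TTheory GRing.Theory Num.Theory.
Local Open Scope ring_scope.

Section QTB.
Variable F : finFieldType.

Definition tb_exps (q r l : nat) (i : nat) : bool :=
  ((i < l)%N && (i %% r != r.-1)%N) || ((i < q.-1)%N && (i %% r == 1 %% r)%N).

Definition nz_coeffs (f : {poly F}) : nat := count (fun a => a != 0) f.

(* Words are functions F -> F; only their values on F^× are meaningful
   (qudits indexed by F^×). *)
Definition in_TB (q r l : nat) (c : F -> F) : Prop :=
  exists p : {poly F}, (forall i, p`_i != 0 -> tb_exps q r l i) /\
    (forall x : F, x != 0 -> c x = p.[x]).

Definition in_TB_dual (q r l : nat) (c : F -> F) : Prop :=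
  forall c', in_TB q r l c' -> \sum_(x : F | x != 0) c x * c' x = 0.

Definition folded_weight (q s : nat) (w : F) (c : F -> F) : nat :=
  #|[set i : 'I_(q.-1 %/ s) |
      [exists k : 'I_s, c (w ^+ (s * i + k)) != 0]]|.
End QTB.

Definition tb_eps (q r l s : nat) : rat :=
  \big[Num.max/0]_(1 <= m < r.+1)
    Num.min ((1 - (l%:R - 1) / (q.-1)%:R) * (m.-1)%:R / r%:R)
            (1 / m%:R + (m.-1)%:R / s%:R).

Definition tb_dist (q r l s : nat) : rat :=
  (q.-1)%:R / s%:R * (1 - (l%:R - 1) / (q.-1)%:R - tb_eps q r l s).

Definition nz_on_roots (F : finFieldType) (r : nat) (f : {poly F}) : nat :=
  #|[set x : F | (x != 0) && (x ^+ r == 1) && (f.[x] != 0)]|.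

(* Main.v *)
Require Import Defs.
From HB Require Import structures.
From mathcomp Require Import all_boot all_order all_algebra.
From mathcomp Require Import perm finfield zify ring lra.
Set Implicit Arguments. Unset Strict Implicit. Unset Printing Implicit Defensive.
Import Order.TTheory GRing.Theory Num.Theory.
Local Open Scope ring_scope.

(** Write the codeword polynomial as the sum of its parts p_b of exponents
    congruent to b mod r, and let m be the number of nonzero p_b.  On a coset
    x Omega_r the word is the polynomial sum_b p_b(x) Z^b evaluated on Omega_r,
    so each nonzero restriction has at least r + 1 - m nonzero values.
    - A word outside the dual has some p_b <> 0 with b <> 1, of degree < l;
      counting the cosets on which p_b does not vanish gives the first term of
      the minimum.
    - Let N be the number of x with p(x) = p(w x) = ... = p(w^(m-1) x) = 0.  The
      folded Wronskian D = det (p_b(w^j X)) is nonzero of degree at most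
      sum_b deg p_b <= m (l-1) + (q-1).  If k points of x Omega_r are counted by
      N, then X - x divides min(k, m) columns of the matrix
      (p_b(w^j X))_(j,b) (z^b)_(b,z) for m suitable z in Omega_r, whose second
      factor is invertible by the uncertainty principle.  Hence D vanishes at x
      to order at least min(k, m) >= k m / r, so m N <= deg D.  An all-zero block
      contains s - m + 1 points counted by N: this gives the second term. *)

(** * Polynomial determinants: divisibility, multiplicities, top coefficients *)

Lemma dvdp_prod (R : idomainType) (I : Type) (s : seq I) (P : pred I)
    (f g : I -> {poly R}) :
  (forall i, P i -> f i %| g i) -> \prod_(i <- s | P i) f i %| \prod_(i <- s | P i) g i.
Proof.
move=> dvd_fg; elim/big_ind2: _ => // p1 p2 q1 q2; exact: dvdp_mul.
Qed.

(** Every term of the Leibniz expansion takes one factor from each column, hence one multiple of [d]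
    from each column in [K]. *)
Lemma dvdp_det_cols (R : idomainType) (m : nat) (A : 'M[{poly R}]_m)
    (K : {set 'I_m}) (d : {poly R}) :
  (forall i j, j \in K -> d %| A i j) -> d ^+ #|K| %| \det A.
Proof.
move=> dvdA; rewrite -det_tr; apply: (big_ind (fun p => d ^+ #|K| %| p)).
- exact: dvdp0.
- by move=> p1 p2; apply: dvdp_add.
move=> u _; apply: dvdp_mull.
rewrite -prodr_const big_mkcond /=; apply: dvdp_prod => j _.
by rewrite mxE; case: ifP => [/dvdA-> // | _]; apply: dvd1p.
Qed.

(** Powers of distinct linear factors are coprime, so their product divides [p]; then compare
    degrees. *)
Lemma sum_multiplicity_lt_size (R : idomainType) (s : seq R) (k : R -> nat)
    (p : {poly R}) :
  uniq s -> p != 0 -> (forall x, x \in s -> ('X - x%:P) ^+ k x %| p) ->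
  (\sum_(x <- s) k x < size p)%N.
Proof.
move=> uniq_s nz_p dvd_p.
have size_prod t : size (\prod_(x <- t) ('X - x%:P) ^+ k x) = (\sum_(x <- t) k x).+1.
  elim: t => [|x t IHt]; first by rewrite !big_nil size_poly1.
  rewrite !big_cons size_mul ?expf_neq0 ?polyXsubC_eq0 //; last first.
    by rewrite -size_poly_eq0 IHt.
  by rewrite IHt size_exp_XsubC addnS.
rewrite -size_prod dvdp_leq //.
elim: s uniq_s dvd_p => [|x s IHs] /=; first by rewrite big_nil dvd1p.
case/andP=> x_s uniq_s dvd_p; rewrite big_cons Gauss_dvdp.
  rewrite dvd_p ?mem_head //= IHs // => y s_y.
  by rewrite dvd_p // inE s_y orbT.
elim: s x_s {IHs uniq_s dvd_p} => [|y s IHs]; first by rewrite big_nil coprimep1.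
rewrite inE negb_or => /andP[neq_xy x_s]; rewrite big_cons coprimepMr IHs // andbT.
by rewrite coprimep_expl ?coprimep_expr // coprimep_XsubC2 // subr_eq0 eq_sym.
Qed.

Lemma coefM_top (R : nzRingType) (p q : {poly R}) (a b : nat) :
  (size p <= a.+1)%N -> (size q <= b.+1)%N -> (p * q)`_(a + b) = p`_a * q`_b.
Proof.
move=> sz_p sz_q; rewrite coefM.
have lt_a : (a < (a + b).+1)%N by lia.
rewrite (bigD1 (Ordinal lt_a)) //= addKn big1 ?addr0 // => i neq_ia.
have {}neq_ia : nat_of_ord i != a by apply: contra neq_ia => /eqP e; apply/eqP/val_inj.
case: (ltngtP i a) neq_ia => // [lt_ia|gt_ia] _.
  by rewrite [q`__]nth_default ?mulr0 //; apply: leq_trans sz_q _; lia.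
by rewrite [p`__]nth_default ?mul0r //; apply: leq_trans sz_p _; lia.
Qed.

Lemma coef_prod_top (R : nzRingType) (I : Type) (s : seq I) (f : I -> {poly R})
    (d : I -> nat) :
  (forall i, (size (f i) <= (d i).+1)%N) ->
  (size (\prod_(i <- s) f i)%R <= (\sum_(i <- s) d i).+1)%N /\
  (\prod_(i <- s) f i)`_(\sum_(i <- s) d i) = \prod_(i <- s) (f i)`_(d i).
Proof.
move=> sz_f; elim: s => [|i s [IHsz IHcoef]].
  by rewrite !big_nil size_poly1 coef1.
rewrite !big_cons coefM_top // IHcoef; split=> //.
by have := sz_f i; have := size_polyMleq (f i) (\prod_(j <- s) f j)%R; lia.
Qed.

(** Each Leibniz term uses every column once, so degree bounds per column add up and the coefficient
    at their sum is computed entrywise. *)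
Lemma coef_det_top (R : comNzRingType) (m : nat) (A : 'M[{poly R}]_m)
    (d : 'I_m -> nat) :
  (forall i j, (size (A i j) <= (d j).+1)%N) ->
  (size (\det A) <= (\sum_j d j).+1)%N /\
  (\det A)`_(\sum_j d j) = \det (\matrix_(i, j) (A i j)`_(d j)).
Proof.
move=> szA; rewrite -det_tr -(det_tr (\matrix_(i, j) _)).
have szAT i j : (size (A^T i j) <= (d i).+1)%N by rewrite mxE.
have top (u : {perm 'I_m}) :=
  @coef_prod_top R _ (index_enum 'I_m) _ d (fun j => szAT j (u j)).
split.
  apply: leq_trans (size_sum _ _ _) _; apply/bigmax_leqP => u _.
  by rewrite mulr_sign; case: (odd_perm u); rewrite ?size_polyN (top u).1.
rewrite coef_sum; apply: eq_bigr => u _; rewrite !mulr_sign.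
have -> : \prod_i (\matrix_(i0, j) (A i0 j)`_(d j))^T i (u i) =
    (\prod_i A^T i (u i))`_(\sum_j d j).
  by rewrite (top u).2; apply: eq_bigr => j _; rewrite !mxE.
by case: (odd_perm u); rewrite ?coefN.
Qed.

(** * Dilations and the folded Wronskian *)

Definition dilate (R : nzRingType) (a : R) (p : {poly R}) : {poly R} :=
  \poly_(i < size p) (a ^+ i * p`_i).

Lemma coef_dilate (R : nzRingType) (a : R) (p : {poly R}) (i : nat) :
  (dilate a p)`_i = a ^+ i * p`_i.
Proof.
rewrite coef_poly; case: ltnP => // le_pi; by rewrite nth_default ?mulr0.
Qed.

Lemma horner_dilate (R : comNzRingType) (a : R) (p : {poly R}) (x : R) :
  (dilate a p).[x] = p.[a * x].
Proof.
rewrite horner_poly horner_coef; apply: eq_bigr => i _.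
by rewrite exprMn mulrCA mulrA.
Qed.

(* The top coefficient of the determinant is, up to the leading coefficients
   of the [g i], a Vandermonde determinant in the [w ^+ deg (g i)]. *)
Lemma det_dilate_neq0 (F : fieldType) (n m : nat) (w : F)
    (g : 'I_m -> {poly F}) :
  n.-primitive_root w -> (forall i, g i != 0) ->
  (forall i, (size (g i) <= n)%N) -> injective (fun i => size (g i)) ->
  let D := \det (\matrix_(j, i) dilate (w ^+ j) (g i)) in
  D != 0 /\ (size D <= (\sum_i (size (g i)).-1).+1)%N.
Proof.
move=> prim_w nz_g sz_g inj_sz D.
have sz i : (0 < size (g i))%N by rewrite size_poly_gt0.
have [|szD coefD] := @coef_det_top F m (\matrix_(j, i) dilate (w ^+ j) (g i))
  (fun i => (size (g i)).-1).
  by move=> j i; rewrite mxE prednK // size_poly.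
split=> //; apply: contraTneq isT => D0.
have : D`_(\sum_i (size (g i)).-1) != 0; last by rewrite D0 coef0 eqxx.
rewrite /D coefD.
pose V := Vandermonde m (\row_i w ^+ (size (g i)).-1).
have -> : \matrix_(i, j) ((\matrix_(j0, i0) dilate (w ^+ j0) (g i0)) i j)`_(size (g j)).-1 =
    V *m diag_mx (\row_i lead_coef (g i)).
  by apply/matrixP => j i; rewrite mul_mx_diag !mxE coef_dilate exprAC.
rewrite det_mulmx det_diag det_Vandermonde mulf_neq0 //; last first.
  by apply/prodf_neq0 => i _; rewrite mxE lead_coef_eq0.
apply/prodf_neq0 => i _; apply/prodf_neq0 => j lt_ij.
(* The exponents are degrees below [n], so equal powers of [w] would force equal sizes, against
   [inj_sz]. *)
rewrite !mxE subr_eq0 (eq_prim_root_expr prim_w) !modn_small.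
- apply: contraTneq lt_ij => e; have /inj_sz -> : size (g j) = size (g i).
    by rewrite -(prednK (sz i)) -(prednK (sz j)) e.
  by rewrite ltnn.
- by rewrite prednK.
- by rewrite prednK.
Qed.

(** * Splitting a polynomial by exponents modulo [r] *)

(** Exponents stay in place, neither shifted nor divided by [r], so the degree keeps its residue [b]
    and an [r]-th root of unity [z] acts on values through [z ^+ b]. *)
Definition residue_part (R : nzRingType) (r b : nat) (p : {poly R}) : {poly R} :=
  \poly_(i < size p) (if (i %% r)%N == b then p`_i else 0).

Lemma coef_residue_part (R : nzRingType) (r b : nat) (p : {poly R}) (i : nat) :
  (residue_part r b p)`_i = if (i %% r)%N == b then p`_i else 0.
Proof. by rewrite coef_poly; case: ltnP => // le_pi; rewrite nth_default ?if_same. Qed.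

Lemma residue_part_neq0P (R : nzRingType) (r b : nat) (p : {poly R}) :
  reflect (exists2 i, (i %% r)%N = b & p`_i != 0) (residue_part r b p != 0).
Proof.
apply: (iffP idP) => [nz_g | [i mod_i nz_pi]]; last first.
  by apply: contraNneq nz_pi => /polyP/(_ i); rewrite coef_residue_part mod_i eqxx coef0 => ->.
move: nz_g; rewrite -lead_coef_eq0 lead_coefE coef_residue_part.
by set i := _.-1; case: ifP => [/eqP mod_i nz_pi | _]; [exists i | rewrite eqxx].
Qed.

Lemma size_residue_part_leq (R : nzRingType) (r b k : nat) (p : {poly R}) :
  (forall i, (i %% r)%N = b -> p`_i != 0 -> (i < k)%N) ->
  (size (residue_part r b p) <= k)%N.
Proof.
move=> lt_k; apply/leq_sizeP => j le_kj; rewrite coef_residue_part.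
case: eqP => // mod_j; apply/eqP; apply: contraLR le_kj => nz_pj.
by rewrite -ltnNge lt_k.
Qed.

Lemma horner_residue_part_unity (R : comNzRingType) (r b : nat) (p : {poly R})
    (z x : R) :
  z ^+ r = 1 -> (residue_part r b p).[z * x] = z ^+ b * (residue_part r b p).[x].
Proof.
move=> zr1; rewrite !horner_poly mulr_sumr; apply: eq_bigr => i _.
case: eqP => [<- | _]; last by rewrite !mul0r mulr0.
by rewrite expr_mod // exprMn mulrCA.
Qed.

Lemma sum_residue_part (R : nzRingType) (r : nat) (p : {poly R}) :
  (0 < r)%N -> p = \sum_(b < r) residue_part r b p.
Proof.
move=> r_gt0; apply/polyP => i; rewrite coef_sum.
rewrite (bigD1 (Ordinal (ltn_pmod i r_gt0))) //= coef_residue_part eqxx.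
rewrite big1 ?addr0 // => b neq_b; rewrite coef_residue_part; case: eqP => // e.
by case/eqP: neq_b; apply: val_inj.
Qed.

Definition residues (R : nzRingType) (r : nat) (p : {poly R}) : seq nat :=
  [seq b <- iota 0 r | residue_part r b p != 0].

Lemma residues_uniq (R : nzRingType) (r : nat) (p : {poly R}) : uniq (residues r p).
Proof. by rewrite filter_uniq ?iota_uniq. Qed.

Lemma mem_residues (R : nzRingType) (r : nat) (p : {poly R}) (b : nat) :
  (b \in residues r p) = (residue_part r b p != 0) && (b < r)%N.
Proof. by rewrite mem_filter mem_iota. Qed.

Lemma size_residues (R : nzRingType) (r : nat) (p : {poly R}) :
  (size (residues r p) <= r)%N.
Proof. by rewrite size_filter (leq_trans (count_size _ _)) ?size_iota. Qed.

(** On the coset of [x], the word becomes a sparse polynomial in [z], to which the uncertainty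
    principle applies. *)
Lemma horner_residues (R : comNzRingType) (r : nat) (p : {poly R}) (z x : R) :
  (0 < r)%N -> z ^+ r = 1 ->
  p.[z * x] = \sum_(b <- residues r p) (residue_part r b p).[x] * z ^+ b.
Proof.
move=> r_gt0 zr1; rewrite {1}(sum_residue_part p r_gt0) horner_sum /residues.
have -> : iota 0 r = index_iota 0 r by rewrite /index_iota subn0.
rewrite big_filter big_mkord [RHS]big_mkcond /=.
apply: eq_bigr => b _; rewrite horner_residue_part_unity // mulrC.
by case: eqP => // ->; rewrite horner0 mul0r.
Qed.

(** * The uncertainty principle for sparse polynomials *)

Definition uncertainty (F : finFieldType) (r : nat) : Prop :=
  forall f : {poly F}, f != 0 -> (size f <= r)%N ->
    (r.+1 <= nz_coeffs f + nz_on_roots r f)%N.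

Lemma uncertainty_sparse (F : finFieldType) (r : nat) (B : seq nat) (a : nat -> F)
    (b : nat) :
  uncertainty F r -> uniq B -> {in B, forall i, (i < r)%N} -> b \in B -> a b != 0 ->
  (r < size B + #|[set z : F | ((z ^+ r == 1) && (\sum_(i <- B) a i * z ^+ i != 0))%R]|)%N.
Proof.
move=> unc uniq_B lt_B Bb nz_ab.
pose f := \poly_(i < r) (if i \in B then a i else 0).
have nz_f : f != 0.
  by apply: contraNneq nz_ab => /polyP/(_ b); rewrite coef_poly lt_B // Bb coef0 => ->.
apply: leq_trans (unc f nz_f (size_poly _ _)) _; apply: leq_add.
  rewrite /nz_coeffs -[X in count _ X](mkseq_nth 0) count_map -size_filter.
  apply: uniq_leq_size; first by rewrite filter_uniq ?iota_uniq.
  move=> i; rewrite mem_filter /= coef_poly => /andP[+ _].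
  by case: ltnP; rewrite ?eqxx //; case: (i \in B); rewrite ?eqxx.
apply/subset_leq_card/subsetP => z; rewrite !inE => /andP[/andP[_ ->] nz_fz] /=.
suff <- : f.[z] = \sum_(i <- B) a i * z ^+ i by [].
have permB : perm_eq B [seq i <- index_iota 0 r | i \in B].
  apply: uniq_perm; rewrite ?filter_uniq ?iota_uniq // => i.
  by rewrite mem_filter mem_index_iota; case: (boolP (i \in B)) => // /lt_B ->.
rewrite (perm_big _ permB) big_filter big_mkcond big_mkord horner_poly; apply: eq_bigr => i _.
by case: ifP; rewrite ?mul0r.
Qed.

(** This is Omega_r: for [r > 0] the equation already excludes 0. *)
Definition unity_roots (F : finFieldType) (r : nat) : {set F} := [set z | z ^+ r == 1].

Lemma card_unity_roots_leq (F : finFieldType) (r : nat) :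
  (0 < r)%N -> (#|unity_roots F r| <= r)%N.
Proof.
move=> r_gt0; rewrite cardE; apply: max_unity_roots; rewrite ?enum_uniq //.
by apply/allP => z; rewrite mem_enum inE => zr1; apply/unity_rootP/eqP.
Qed.

Lemma card_unity_roots (F : finFieldType) (r : nat) (w : F) :
  r.-primitive_root w -> #|unity_roots F r| = r.
Proof.
move=> prim_w; have r_gt0 := prim_order_gt0 prim_w; apply/eqP.
rewrite eqn_leq card_unity_roots_leq //= -[X in (X <= _)%N]card_ord.
rewrite -(@card_imset _ _ (fun i : 'I_r => w ^+ i)).
  apply/subset_leq_card/subsetP => _ /imsetP[i _ ->].
  by rewrite inE exprAC (prim_expr_order prim_w) expr1n.
move=> i j /eqP; rewrite (eq_prim_root_expr prim_w) !modn_small //.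
by move/eqP/val_inj.
Qed.

(** With at least [size B] zeros among at most [r] roots of unity, at most [r - size B] nonzero
    values remain, too few for a nonzero polynomial supported on [B]. This makes the generalized
    Vandermonde matrices on Omega_r invertible. *)
Lemma uncertainty_sparse_zeros (F : finFieldType) (r : nat) (B : seq nat)
    (T : seq F) (a : nat -> F) :
  uncertainty F r -> (0 < r)%N -> uniq B -> {in B, forall i, (i < r)%N} ->
  uniq T -> {subset T <= unity_roots F r} -> (size B <= size T)%N ->
  {in T, forall z, \sum_(i <- B) a i * z ^+ i = 0} ->
  {in B, forall i, a i = 0}.
Proof.
move=> unc r_gt0 uniq_B lt_B uniq_T sTU le_BT zero_T b Bb.
apply: contraTeq isT => nz_ab; have := uncertainty_sparse unc uniq_B lt_B Bb nz_ab.
set N := [set _ | _]; rewrite ltnNge; case/negP.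
apply: leq_trans (card_unity_roots_leq F r_gt0); apply: leq_trans (leq_add le_BT (leqnn _)) _.
have <- : #|[set z in T]| = size T by rewrite cardsE; apply/card_uniqP.
rewrite -cardsUI (_ : _ :&: _ = set0) ?cards0 ?addn0; last first.
  apply/setP => z; rewrite !inE; apply/negP => /andP[Tz /andP[_ /eqP[]]].
  exact: zero_T.
apply/subset_leq_card; rewrite subUset; apply/andP; split; apply/subsetP => z.
  by rewrite inE => /sTU.
by rewrite !inE => /andP[].
Qed.

(** * Counting over cosets *)

(** Double counting: for fixed [z] in [A], multiplication by [z] permutes the nonzero elements. This
    averages over cosets without choosing representatives. *)
Lemma sum_card_translates (F : finFieldType) (A : {set F}) (P : pred F) :
  0 \notin A ->
  (\sum_(x : F | (x != 0)%R) #|[set z in A | P (z * x)%R]| =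
   #|A| * #|[set x | (x != 0)%R && P x]|)%N.
Proof.
move=> A0; under eq_bigr => x _ do rewrite -sum1dep_card big_mkcondr /=.
rewrite exchange_big /= -sum_nat_const; apply: eq_bigr => z Az.
have nz_z : z != 0 by apply: contraNneq A0 => <-.
rewrite -sum1dep_card big_mkcondr /= [RHS](reindex_inj (mulfI nz_z)) /=.
by apply: eq_bigl => x; rewrite mulf_eq0 (negPf nz_z).
Qed.

(** List [A] first, then the rest of [U], and keep the first [m] entries. *)
Lemma exists_seq_meeting (T : finType) (U A : {set T}) (m : nat) :
  A \subset U -> (m <= #|U|)%N ->
  exists s : seq T, [/\ uniq s, size s = m, {subset s <= U} &
    (minn #|A| m <= count (mem A) s)%N].
Proof.
move=> sAU le_mU; exists (take m (enum A ++ enum (U :\: A))); split.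
- apply: take_uniq; rewrite cat_uniq !enum_uniq andbT /=.
  apply/hasPn => x; rewrite !mem_enum inE => /andP[]; exact.
- by rewrite size_takel // size_cat -!cardE cardsD (setIidPr sAU) subnKC ?subset_leq_card.
- move=> x /mem_take; rewrite mem_cat !mem_enum inE.
  by case/orP => [/(subsetP sAU) | /andP[]].
have allA s : {subset s <= enum A} -> count (mem A) s = size s.
  by move=> sA; apply/eqP; rewrite -all_count; apply/allP => x /sA; rewrite mem_enum.
rewrite take_cat -cardE; case: ltnP => [lt_mA | le_Am].
  rewrite allA => [|x /mem_take //]; rewrite size_takel // -cardE.
  exact: ltnW.
by rewrite count_cat allA // [X in (X <= _)%N]cardE leq_addr.
Qed.

(** * Common zeros and weights of codeword polynomials *)

Definition vanishes_along (F : finFieldType) (w : F) (m : nat) (p : {poly F}) : pred F :=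
  fun x => [forall j : 'I_m, p.[w ^+ j * x] == 0].

Lemma zeros_multiplicity (F : finFieldType) (r : nat) (w : F) (p : {poly F}) (x : F) :
  let B := residues r p in let m := size B in
  uncertainty F r -> (m <= #|unity_roots F r|)%N -> (0 < r)%N ->
  ('X - x%:P) ^+ minn #|[set z in unity_roots F r | vanishes_along w m p (z * x)]| m %|
    \det (\matrix_(j < m, i < m) dilate (w ^+ j) (residue_part r (nth 0%N B i) p)).
Proof.
move=> B m unc le_mU r_gt0; set A := [set z in _ | _]; set M := \matrix_(_, _) _.
have sAU : A \subset unity_roots F r by apply/subsetP => z; rewrite inE => /andP[].
have [T [uniq_T size_T sTU le_AT]] := exists_seq_meeting sAU le_mU.
pose V := \matrix_(i < m, c < m) (nth 0 T c ^+ nth 0%N B i).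
have lt_B : {in B, forall b, (b < r)%N} by move=> b; rewrite mem_residues => /andP[].
have unit_V : V \in unitmx.
  rewrite -row_free_unit; apply: inj_row_free => v vV0.
  (* A row vector [v] killed by [V] is read as coefficients indexed by the residues in [B]; the
     resulting sparse polynomial vanishes on all of [T]. *)
  pose a b := if insub (index b B) is Some i then v 0 i else 0 : F.
  have a_nth (i : 'I_m) : a (nth 0%N B i) = v 0 i.
    by rewrite /a index_uniq ?residues_uniq // insubT // => lt_im; congr (v 0 _); apply: val_inj.
  have a0 : {in B, forall b, a b = 0}.
    apply: (@uncertainty_sparse_zeros F r B T) => //; rewrite ?residues_uniq ?size_T //.
    move=> z Tz; have lt_z : (index z T < m)%N by rewrite -size_T index_mem.
    rewrite (big_nth 0%N) big_mkord -/m.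
    have /matrixP/(_ 0 (Ordinal lt_z)) := vV0; rewrite !mxE => e.
    rewrite -[RHS]e; apply: eq_bigr => i _; by rewrite a_nth !mxE /= nth_index.
  by apply/rowP => i; rewrite mxE -a_nth a0 // mem_nth.
pose K := [set c : 'I_m | nth 0 T c \in A].
have card_K : (minn #|A| m <= #|K|)%N.
  apply: leq_trans le_AT _.
  by rewrite -sum1dep_card -sum1_count (big_nth 0) size_T big_mkord.
apply: (dvdp_trans (dvdp_exp2l _ card_K)).
have nz_detV : \det V != 0 by rewrite -unitfE -unitmxE.
(* As [\det V] is a nonzero constant, it suffices to treat the product of [M] and [V], whose entry
   [(j, c)] takes at [x] the value of [p] at [w ^+ j * (z * x)], with [z] the entry [c] of [T]. *)
rewrite -(dvdpZr _ _ nz_detV) -mul_polyC -det_map_mx mulrC -det_mulmx.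
apply: dvdp_det_cols => j c; rewrite inE => Ac.
rewrite dvdp_XsubCl rootE !mxE horner_sum.
under eq_bigr => i _ do rewrite !mxE hornerM hornerC horner_dilate.
move: Ac; rewrite !inE => /andP[/eqP zr1 /forallP/(_ j)/eqP].
rewrite mulrCA (horner_residues p _ r_gt0 zr1) (big_nth 0%N) big_mkord => -> //.
Qed.

Lemma common_zeros_bound (F : finFieldType) (n r : nat) (w : F) (p : {poly F}) :
  let B := residues r p in let m := size B in
  uncertainty F r -> n.-primitive_root w -> (r %| n)%N -> (0 < r)%N ->
  (size p <= n)%N ->
  (m * #|[set x : F | (x != 0)%R && vanishes_along w m p x]|
     <= \sum_(b <- B) (size (residue_part r b p)).-1)%N.
Proof.
move=> B m unc prim_w dvd_rn r_gt0 sz_p; set N := [set x | _].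
have cardU := card_unity_roots (dvdn_prim_root prim_w dvd_rn).
have le_mr : (m <= r)%N := size_residues r p.
pose M := \matrix_(j < m, i < m) dilate (w ^+ j) (residue_part r (nth 0%N B i) p).
have nz_g (i : 'I_m) : residue_part r (nth 0%N B i) p != 0.
  by have := mem_nth 0%N (ltn_ord i); rewrite mem_residues => /andP[].
have [||nz_D sz_D] := det_dilate_neq0 prim_w nz_g; rewrite -/M.
- by move=> i; apply: leq_trans (size_poly _ _) sz_p.
- move=> i1 i2 /= eq_sz; apply/val_inj/eqP.
  rewrite -(nth_uniq 0%N (ltn_ord i1) (ltn_ord i2) (residues_uniq r p)).
  (* The degree of a nonzero residue part is congruent to its residue, so distinct parts have
     distinct degrees. *)
  have mod_g (i : 'I_m) : ((size (residue_part r (nth 0%N B i) p)).-1 %% r)%N = nth 0%N B i.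
    have := nz_g i; rewrite -lead_coef_eq0 lead_coefE coef_residue_part.
    by set k := _.-1; case: ifP => [/eqP | _]; rewrite ?eqxx.
  by rewrite -mod_g eq_sz mod_g.
pose k x := #|[set z in unity_roots F r | vanishes_along w m p (z * x)]|.
have le_mU : (m <= #|unity_roots F r|)%N by rewrite cardU.
have := sum_multiplicity_lt_size (filter_uniq (fun x => x != 0) (enum_uniq F)) nz_D
  (fun x _ => zeros_multiplicity w x unc le_mU r_gt0).
rewrite big_filter big_enum_cond /= -/(k _) => lt_D.
have {lt_D} : (\sum_(x : F | (x != 0)%R) minn (k x) m <=
    \sum_(b <- B) (size (residue_part r b p)).-1)%N.
  by rewrite (big_nth 0%N) big_mkord -ltnS (leq_trans lt_D).
(* The numbers [k x] sum to [r * #|N|], and [r * minn (k x) m >= m * k x] because both [k x] and [m]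
   are at most [r]. *)
move/(leq_mul (leqnn r)); apply: contraTT; rewrite -!ltnNge => lt_sum.
have U0 : 0 \notin unity_roots F r by rewrite inE expr0n gtn_eqF // eq_sym oner_eq0.
have := sum_card_translates (vanishes_along w m p) U0; rewrite cardU => eq_sum.
apply: (@leq_trans (m * (r * #|N|))); first by rewrite mulnCA ltn_pmul2l.
rewrite -eq_sum !big_distrr /=; apply: leq_sum => x _; rewrite -/(k x).
have : (k x <= r)%N.
  by rewrite -cardU subset_leq_card //; apply/subsetP => z; rewrite inE => /andP[].
by case: (leqP (k x) m); nia.
Qed.

(** Wherever [residue_part r b p] is nonzero, the word restricted to that coset is a nonzero sparse
    polynomial; the bound sums the uncertainty principle over such points. *)
Lemma low_degree_weight (F : finFieldType) (q r l : nat) (p : {poly F}) (b : nat) :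
  uncertainty F r -> #|F| = q -> (0 < r)%N ->
  b \in residues r p -> (size (residue_part r b p) <= l)%N ->
  ((q - l) * (r.+1 - size (residues r p)) <=
    r * #|[set x : F | ((x != 0) && (p.[x] != 0))%R]|)%N.
Proof.
move=> unc card_F r_gt0 Bb sz_g; set g := residue_part r b p.
have nz_g : g != 0 by move: Bb; rewrite mem_residues => /andP[].
have lt_B : {in residues r p, forall i, (i < r)%N}.
  by move=> i; rewrite mem_residues => /andP[].
have U0 : 0 \notin unity_roots F r by rewrite inE expr0n gtn_eqF // eq_sym oner_eq0.
pose G := [set x : F | (x != 0) && (g.[x] != 0)].
have card_G : (q - l <= #|G|)%N.
  (* The complement consists of 0 and the roots of [g]; there are fewer roots than [size g], which
     absorbs the extra point 0. *)
  have le_l : (#|~: G| <= l)%N.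
    have -> : ~: G = [set x in 0 :: enum (root g)].
      apply/setP => x; rewrite !inE mem_enum rootE negb_and !negbK; by [].
    rewrite cardsE; apply: leq_trans (card_size _) _ => /=.
    apply: leq_trans sz_g; apply: max_poly_roots => //; rewrite ?enum_uniq //.
    by apply/allP => x; rewrite mem_enum.
  by rewrite leq_subLR -card_F -(cardsC G) addnC leq_add2r.
have := sum_card_translates (fun x => p.[x] != 0) U0.
move=> eq_sum.
apply: (@leq_trans (#|unity_roots F r| * #|[set x : F | ((x != 0) && (p.[x] != 0))%R]|)); last first.
  by rewrite leq_mul2r card_unity_roots_leq ?orbT.
rewrite -eq_sum; apply: leq_trans (leq_mul card_G (leqnn _)) _.
rewrite -sum_nat_const big_mkcond [leqRHS]big_mkcond /=; apply: leq_sum => x _.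
rewrite inE; case: eqP => //= _; case: eqP => // /eqP nz_gx.
rewrite leq_subLR.
apply: leq_trans (@uncertainty_sparse F r _ (fun i => (residue_part r i p).[x]) b
  unc (residues_uniq r p) lt_B Bb nz_gx) _.
rewrite leq_add2l subset_leq_card //; apply/subsetP => z; rewrite !inE.
by case/andP => /eqP zr1; rewrite -horner_residues // zr1 eqxx.
Qed.

(** * Words orthogonal to the code *)

(** Substituting [z * x] for [x] multiplies the sum by [z ^+ k], which differs from 1. *)
Lemma sum_nonzero_expr (F : finFieldType) (r k : nat) (z : F) :
  r.-primitive_root z -> ~~ (r %| k)%N -> \sum_(x : F | x != 0) x ^+ k = 0.
Proof.
move=> prim_z ndvd; have nz_z : z != 0.
  apply: contra_eq_neq (prim_expr_order prim_z) => ->.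
  by rewrite expr0n gtn_eqF ?(prim_order_gt0 prim_z) // eq_sym oner_eq0.
have zk1 : z ^+ k - 1 != 0 by rewrite subr_eq0 -(prim_order_dvd prim_z).
apply: (mulfI zk1); rewrite mulr0 mulrBl mul1r mulr_sumr.
rewrite [X in _ - X](reindex_inj (mulfI nz_z)) /=.
apply/eqP; rewrite subr_eq0; apply/eqP; apply: eq_big => x.
  by rewrite mulf_eq0 (negPf nz_z).
by rewrite exprMn.
Qed.

(** Only exponents divisible by [r] survive summation. An exponent congruent to 1 would need a
    partner congruent to -1, and the code has none. *)
Lemma residue_one_in_dual (F : finFieldType) (q r l : nat) (z : F) (p : {poly F})
    (c : F -> F) :
  r.-primitive_root z -> (3 <= r)%N -> (forall i, p`_i != 0 -> (i %% r)%N = 1%N) ->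
  (forall x, x != 0 -> c x = p.[x]) -> in_TB_dual q r l c.
Proof.
move=> prim_z r_ge3 supp_p c_p c' [p' [supp_p' c'_p']].
transitivity (\sum_(x : F | x != 0) (p * p').[x]).
  by apply: eq_bigr => x nz_x; rewrite c_p // c'_p' // hornerM.
under eq_bigr => x _ do rewrite horner_coef.
rewrite exchange_big big1 //= => k _; rewrite -mulr_sumr.
have [dvd_rk | ndvd] := boolP (r %| k)%N; last first.
  by rewrite (sum_nonzero_expr prim_z) ?mulr0.
rewrite coefM big1 ?mul0r // => i _.
have [-> | nz_pi] := eqVneq p`_i 0; first by rewrite mul0r.
have [-> | nz_pj] := eqVneq p'`_(k - i) 0; first by rewrite mulr0.
have mod_i := supp_p _ nz_pi; have le_ik := leq_ord i.
exfalso; have : ((i + (k - i)) %% r = 0)%N by rewrite subnKC //; apply/eqP.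
have := supp_p' _ nz_pj; rewrite -modnDm mod_i /tb_exps (@modn_small 1) ?(leq_trans _ r_ge3) //.
have r_gt0 : (0 < r)%N by lia.
have := ltn_pmod (k - i) r_gt0; set j := ((k - i) %% r)%N => lt_jr.
case: (ltngtP (1 + j) r) => [lt_j | gt_j | eq_j]; [by rewrite modn_small | by lia | ].
(* Here [j] is [r.-1]: the first clause of [tb_exps] excludes it, and the second would give
   [r = 2]. *)
move=> + _; rewrite -eq_j /= eqxx andbF /= => /andP[_ /eqP]; lia.
Qed.

(** * Comparing positions with blocks *)

Lemma weight_le_folded_weight (F : finFieldType) (q s : nat) (w : F) (c : F -> F) :
  #|F| = q -> (s %| q.-1)%N -> (q.-1).-primitive_root w ->
  (#|[set x : F | ((x != 0) && (c x != 0))%R]| <= s * folded_weight q s w c)%N.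
Proof.
move=> card_F dvd_s prim_w.
have n_gt0 := prim_order_gt0 prim_w.
have s_gt0 : (0 < s)%N by apply: dvdn_gt0 dvd_s.
rewrite mulnC -[X in (_ * X)%N]card_ord -cardsT /folded_weight -cardsX.
set I := finset.setX _ _.
apply: leq_trans (leq_imset_card (fun ik : 'I_(q.-1 %/ s) * 'I_s => w ^+ (s * ik.1 + ik.2)) I).
apply/subset_leq_card/subsetP => x; rewrite inE => /andP[nz_x nz_cx].
have xn1 : x ^+ q.-1 = 1.
  apply: (mulfI nz_x); rewrite mulr1 -exprS prednK ?expf_card //; last by lia.
  by rewrite -card_F expf_card.
have [e x_e] := prim_rootP prim_w xn1.
have lt_i : (e %/ s < q.-1 %/ s)%N by rewrite ltn_divLR // divnK.
have lt_k : (e %% s < s)%N by rewrite ltn_mod.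
have e_ik : (s * (e %/ s) + e %% s)%N = e by rewrite mulnC -divn_eq.
apply/imsetP; exists (Ordinal lt_i, Ordinal lt_k); last by rewrite /= e_ik.
by rewrite !inE andbT; apply/existsP; exists (Ordinal lt_k); rewrite /= e_ik -x_e.
Qed.

(** In an all-zero block, each of the first [s - m.-1] positions starts a window of [m] zeros that
    stays inside the block. *)
Lemma folded_zeros_le (F : finFieldType) (q s m : nat) (w : F) (p : {poly F})
    (c : F -> F) :
  (s %| q.-1)%N -> (q.-1).-primitive_root w -> (forall x, x != 0 -> c x = p.[x]) ->
  ((q.-1 %/ s - folded_weight q s w c) * (s - m.-1) <=
    #|[set x : F | ((x != 0) && vanishes_along w m p x)%R]|)%N.
Proof.
move=> dvd_s prim_w c_p; have n_gt0 := prim_order_gt0 prim_w.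
have nz_w : w != 0.
  apply: contra_eq_neq (prim_expr_order prim_w) => ->.
  by rewrite expr0n gtn_eqF // eq_sym oner_eq0.
rewrite /folded_weight; set S := [set i | _].
have -> : (q.-1 %/ s - #|S| = #|~: S|)%N.
  by rewrite -[X in (X - _)%N](card_ord (q.-1 %/ s)) -(cardsC S) addKn.
rewrite -[X in (_ * X)%N]card_ord -cardsT -cardsX.
have lt_n (i : 'I_(q.-1 %/ s)) t : (t < s)%N -> (s * i + t < q.-1)%N.
  by move=> lt_ts; have := ltn_ord i; have := divnK dvd_s; nia.
rewrite -(card_in_imset (f := fun it : 'I_(q.-1 %/ s) * 'I_(s - m.-1) => w ^+ (s * it.1 + it.2))).
  apply/subset_leq_card/subsetP => _ /imsetP[[i t] /= + ->].
  rewrite !inE andbT expf_neq0 //= => /existsPn zero_i.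
  apply/forallP => j; have lt_s : (t + j < s)%N by have := ltn_ord t; have := ltn_ord j; lia.
  have := zero_i (Ordinal lt_s); rewrite negbK c_p ?expf_neq0 //=.
  by rewrite -exprD addnA addnC.
move=> [i t] [i' t'] _ _ /= /eqP.
have lt_t := ltn_ord t; have lt_t' := ltn_ord t'.
rewrite (eq_prim_root_expr prim_w) !modn_small ?lt_n; try lia.
move/eqP => e; have e_i : nat_of_ord i = i'.
  have : ((s * i + t) %/ s = (s * i' + t') %/ s)%N by rewrite e.
  by rewrite ![(s * _)%N]mulnC !divnMDl ?(@divn_small t) ?(@divn_small t') ?addn0 //; lia.
by congr pair; apply: val_inj => //; move: e; rewrite e_i => /addnI.
Qed.

(** * Arithmetic of the distance bound *)

Lemma tb_eps_ge (q r l s m : nat) :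
  (0 < m <= r)%N ->
  Num.min ((1 - (l%:R - 1) / (q.-1)%:R) * (m.-1)%:R / r%:R)
          (1 / m%:R + (m.-1)%:R / s%:R) <= tb_eps q r l s.
Proof. by move=> lt_m; apply: (@le_bigmax_seq _ _ _ _ _ m); rewrite ?mem_index_iota ?ltnS. Qed.

(* In the application [m] is the number of nonzero residue parts, [W] the
   unfolded weight, [k] the folded weight, and [N] the number of [x] with
   [p.[w ^+ j * x] = 0] for all [j < m]. *)
Lemma tb_dist_le (q r l s m k W N : nat) :
  (0 < r)%N -> (0 < s)%N -> (s %| q.-1)%N -> (0 < q.-1)%N -> (0 < l)%N ->
  (l <= q.-1)%N -> (0 < m <= r)%N ->
  ((q - l) * (r.+1 - m) <= r * W)%N -> (W <= s * k)%N ->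
  (m * N <= m * l.-1 + q.-1)%N -> ((q.-1 %/ s - k) * (s - m.-1) <= N)%N ->
  tb_dist q r l s <= k%:R.
Proof.
move=> r_gt0 s_gt0 /dvdnP[d eq_d] n_gt0 l_gt0 le_ln m_bounds le_W le_sk le_N le_fold.
have := tb_eps_ge q l s m_bounds; rewrite /tb_dist ge_min.
have [m_gt0 le_mr] := andP m_bounds.
set n := q.-1 in eq_d n_gt0 le_ln le_N le_fold *.
have eq_q : q = n.+1 by rewrite /n; lia.
rewrite eq_d mulnK // in le_fold.
have nR : n%:R = d%:R * s%:R :> rat by rewrite eq_d natrM.
have n_neq0 : n%:R != 0 :> rat by rewrite pnatr_eq0 -lt0n.
have s_pos : 0 < s%:R :> rat by rewrite ltr0n.
have r_pos : 0 < r%:R :> rat by rewrite ltr0n.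
have m_pos : 0 < m%:R :> rat by rewrite ltr0n.
have n_pos : 0 < n%:R :> rat by rewrite ltr0n.
move=> eps_ge.
(* Whichever term attains the minimum at [m] serves as [X]; replacing [tb_eps] by this smaller
   number only strengthens the bound. *)
suff [X X_le bound] : exists2 X, X <= tb_eps q r l s &
    n%:R * (1 - (l%:R - 1) / n%:R - X) <= s%:R * k%:R :> rat.
  rewrite mulrAC ler_pdivrMr // [k%:R * _]mulrC; apply: le_trans bound.
  by rewrite ler_pM2l // lerD2l lerN2.
case/orP: eps_ge => X_le; [eexists; first exact: X_le | eexists; first exact: X_le].
  have : ((q - l) * (r.+1 - m))%:R <= (r * (s * k))%:R :> rat.
    by rewrite ler_nat (leq_trans le_W) // leq_mul2l le_sk orbT.
  have -> : (q - l)%N = (n - l.-1)%N by lia.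
  have -> : (r.+1 - m)%N = (r - m.-1)%N by lia.
  rewrite !natrM !natrB; try lia.
  rewrite -[in l%:R - 1](prednK l_gt0) -natr1 addrK => le_rsk.
  rewrite -(ler_pM2l r_pos) (le_trans _ le_rsk) // le_eqVlt; apply/orP; left.
  by apply/eqP; field; rewrite n_neq0 gt_eqF.
have le_n : (n <= s * k + N + m.-1 * d)%N.
  (* The natural subtraction [d - k] truncates, so [d <= k] is separate: there [s * k] alone covers
     [n]. Otherwise each zero block loses at most [m.-1] window starts. *)
  have [le_dk | lt_kd] := leqP d k.
    by rewrite eq_d [(d * s)%N]mulnC -addnA (leq_trans (leq_mul (leqnn s) le_dk)) ?leq_addr.
 
  have le_Md : (m.-1 * (d - k) <= m.-1 * d)%N by rewrite leq_mul2l leq_subr orbT.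
  have : (s * (d - k) <= N + m.-1 * (d - k))%N.
    apply: leq_trans (leq_add le_fold (leqnn _)); nia.
  have : (d * s = s * k + s * (d - k))%N by rewrite -mulnDr subnKC 1?mulnC // ltnW.
  by rewrite eq_d; lia.
move: le_n le_N; rewrite -(ler_nat rat) -[(m * N <= _)%N](ler_nat rat).
rewrite -[in l%:R - 1](prednK l_gt0) -natr1 addrK !natrD !natrM => le_n le_N.
have le_N' : N%:R <= l.-1%:R + n%:R / m%:R :> rat.
  rewrite -(ler_pM2l m_pos) (le_trans le_N) // le_eqVlt; apply/orP; left.
  by apply/eqP; field; rewrite gt_eqF.
have -> : n%:R * (1 - l.-1%:R / n%:R - (1 / m%:R + m.-1%:R / s%:R)) =
    n%:R - l.-1%:R - n%:R / m%:R - m.-1%:R * d%:R :> rat.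
  rewrite nR; field; rewrite !gt_eqF //=.
  by move: n_pos; rewrite nR pmulr_lgt0.
by lra.
Qed.

Theorem theorem6p3 (F : finFieldType) (q r l s : nat) (w : F) :
  #|F| = q ->
  prime r -> (r %| q.-1)%N -> (3 <= r)%N ->
  (q <= 2 * l)%N -> (l <= q.-1)%N ->
  (s %| q.-1 %/ r)%N ->
  (q.-1).-primitive_root w ->
  (forall f : {poly F}, f != 0 -> (size f <= r)%N ->
     (r.+1 <= nz_coeffs f + nz_on_roots r f)%N) ->
  forall c : F -> F, in_TB q r l c -> ~ in_TB_dual q r l c ->
    tb_dist q r l s <= (folded_weight q s w c)%:R.
Proof.
move=> card_F _ dvd_r r_ge3 q_le2l le_ln dvd_sr prim_w unc c [p [supp_p c_p]] not_dual.
have r_gt0 : (0 < r)%N by lia.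
have n_gt0 := prim_order_gt0 prim_w.
have dvd_s : (s %| q.-1)%N by apply: dvdn_trans dvd_sr _; apply: dvdn_div.
have s_gt0 : (0 < s)%N by apply: dvdn_gt0 dvd_s.
have l_gt0 : (0 < l)%N by lia.
(* Only residue 1 may carry exponents from [l] up to [q - 2]. *)
have size_part b : (size (residue_part r b p) <= (if b == 1 then q.-1 else l))%N.
  apply: size_residue_part_leq => i mod_i /supp_p.
  rewrite /tb_exps mod_i (@modn_small 1) ?(leq_trans _ r_ge3) //.
  case: (b =P 1%N) => _; last by rewrite andbF orbF => /andP[].
  by case/orP=> /andP[lt_i _] //; apply: leq_trans lt_i le_ln.
(* If residue 1 were the only one present, [c] would lie in the dual. *)
have [b Bb neq_b1] : exists2 b, b \in residues r p & b != 1%N.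
  apply/hasP; apply: contra_notT not_dual => /hasPn all1.
  apply: (residue_one_in_dual (dvdn_prim_root prim_w dvd_r) r_ge3) c_p => i nz_pi.
  apply/eqP; apply: contraTT nz_pi => neq_i; apply/negPn.
  have := all1 (i %% r)%N.
  rewrite mem_residues ltn_pmod // andbT neq_i => /contraTT/(_ isT).
  by move/residue_part_neq0P => H; apply/negPn/negP => nz_pi; case: H; exists i.
have size_p : (size p <= q.-1)%N.
  apply/leq_sizeP => j le_j; apply: contraTeq le_j => /supp_p; rewrite -ltnNge /tb_exps.
  by case/orP=> /andP[lt_j _] //; apply: leq_trans lt_j le_ln.
(* Residue 1 occurs at most once, so its larger degree costs a single extra [q.-1]. *)
have sum_size : (\sum_(i <- residues r p) (size (residue_part r i p)).-1 <=
    size (residues r p) * l.-1 + q.-1)%N.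
  have uniq_B := residues_uniq r p.
  apply: (@leq_trans (\sum_(i <- residues r p) (l.-1 + (i == 1%N) * q.-1))%N).
    apply: leq_sum => i _; have := size_part i; case: eqP => _; lia.
  rewrite big_split /= big_const_seq count_predT iter_addn_0 mulnC leq_add2l -big_distrl /=.
  have -> : (\sum_(i <- residues r p) (i == 1%N) = count_mem 1%N (residues r p))%N.
    by rewrite -sum1_count [RHS]big_mkcond; apply: eq_bigr => i _ /=; case: eqP.
  by rewrite count_uniq_mem // -[leqRHS]mul1n leq_mul2r leq_b1 orbT.
have weight_c : [set x : F | (x != 0) && (p.[x] != 0)] = [set x : F | (x != 0) && (c x != 0)].
  by apply/setP => x; rewrite !inE; case: eqP => //= /eqP/c_p ->.
apply: (@tb_dist_le _ _ _ _ (size (residues r p))) (low_degree_weight unc card_F r_gt0 Bb _) _ _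
  (folded_zeros_le _ dvd_s prim_w c_p) => //.
- by case: (residues r p) Bb (size_residues r p).
- by have := size_part b; rewrite (negPf neq_b1).
- by rewrite weight_c weight_le_folded_weight.
exact: leq_trans (common_zeros_bound unc prim_w dvd_r r_gt0 size_p) sum_size.
Qed.
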